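(* Let $G$ be a finite group with identity $e$, let $H$ be a proper subgroup of $G$ with right cosets $Hg_1,\dots,Hg_n$, where $g_1=e$ and $n=|G:H|$, and let $(v,k,\lambda,m,s)$ be a feasible tuple with $v=|G|$ and $s=|H|$. Run the enumeration algorithm described in the context on this input, and let $\mathcal N$ be its output. Then the algorithm finishes in finite time and the following hold: (1) $\mathcal N$ consists of Neumaier Cayley graphs over $G$ with parameters $(v,k,\lambda,m,s)$ and with a spread given by the $H$-cosets. (2) Every Neumaier Cayley graph over $G$ with parameters $(v,k,\lambda,m,s)$ and with a spread given by the $H$-cosets is isomorphic to some graph from $\mathcal N$.
   Context: For a subset $X$ of a group, $X^\#$ is the set of its nonidentity elements and $X^{-1}=\{x^{-1}:x\in X\}$. For an identity-free subset $S=S^{-1}$ of a finite group $G$, the Cayley graph $\mathrm{Cay}(G,S)$ over $G$ has vertex set $G$ and the neighbourhood of $g$ is $Sg$. A clique in a regular graph is $m$-regular ($m\ge 1$) if every vertex outside it is adjacent to exactly $m$ of its vertices; a regular clique is a clique that is $m$-regular for some $m\ge 1$. A Neumaier graph is a finite non-complete edge-regular graph (regular, any two adjacent vertices have the same number $\lambda$ of common neighbours) containing a regular clique; it has parameters $(v,k,\lambda,m,s)$ if it has $v$ vertices, is $k$-regular, any two adjacent vertices have exactly $\lambda$ common neighbours, and it has an $m$-regular clique of size $s$. A spread is a partition of the vertex set into regular cliques; a Cayley graph over $G$ has a spread given by the $H$-cosets if the right cosets $Hg$, $g\in G$, form a spread (each coset is a regular clique). A feasible tuple means a tuple of integers $(v,k,\lambda,m,s)$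 with $m\ge 1$, $s\ge 1$, $\lambda\ge0$, $s\mid v$, $k=s-1+(v/s-1)m$, and $k<v-1$. The enumeration algorithm. Input: $(v,k,\lambda,m,s)$, $G$, $H$, and the cosets $Hg_1,\dots,Hg_n$. Initialise $\mathcal N=\varnothing$. Let $S_2$ be a set of representatives of the orbits of the setwise stabiliser $\mathrm{Stab}_{\mathrm{Aut}\,G}(Hg_2)$ acting on the $m$-element subsets of $Hg_2$. For each $T_2\in S_2$: if $T_2^{-1}\cap(Hg_2\setminus T_2)\neq\varnothing$, go to the next $T_2$. Then, by nested loops over $j=3,\dots,n$, given already chosen $T_2,\dots,T_{j-1}$: put $R_j=Hg_j\cap(T_2^{-1}\cup\dots\cup T_{j-1}^{-1})$; if $|R_j|>m$, discard the current $T_{j-1}$ and go to the next choice of it; otherwise let $\overline{T_j}$ run over all $(m-|R_j|)$-element subsets of $Hg_j\setminus R_j$, put $T_j=\overline{T_j}\cup R_j$, and if $T_j^{-1}\cap\big((Hg_2\cup\dots\cup Hg_j)\setminus(T_2\cup\dots\cup T_j)\big)\ne\varnothing$, go to the next $\overline{T_j}$. Whenever $T_2,\dots,T_n$ have all been chosen, put $T=T_2\cup\dots\cup T_n$; if $T=T^{-1}$, $|Th\cap T|=\lambda-s+2$ for every $h\in H^\#$, and $|Tg\cap T|=\lambda-2m+2$ for every $g\in T$, then add $\mathrm{Cay}(G,H^\#\cup T)$ to $\mathcal N$. The output is $\mathcal N$ after all loops have finished. *)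

(* Defs.v *)
From Stdlib Require Import Relation_Operators.
From mathcomp Require Import all_boot all_order all_algebra all_fingroup.

Set Implicit Arguments.
Unset Strict Implicit.
Unset Printing Implicit Defensive.

Import GroupScope.

(* A graph on V is given by its neighbourhood function; it is a simple graph
   when [simple_graph] holds. *)
Definition graph (V : finType) := {ffun V -> {set V}}.

Section Graphs.

Variable V : finType.
Implicit Types (Gam : graph V) (C : {set V}) (P : {set {set V}}).

Definition simple_graph Gam : Prop :=
  (forall x, x \notin Gam x) /\ (forall x y, (y \in Gam x) = (x \in Gam y)).

Definition complete_graph Gam : Prop := forall x y, x != y -> y \in Gam x.

Definition regular_graph k Gam : Prop := forall x, #|Gam x| = k.

Definition edge_regular v k lam Gam : Prop :=
  [/\ simple_graph Gam, #|V| = v, regular_graph k Gam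
    & forall x y, y \in Gam x -> #|Gam x :&: Gam y| = lam].

Definition is_clique Gam C : Prop :=
  {in C &, forall x y, x != y -> y \in Gam x}.

Definition m_regular_clique m Gam C : Prop :=
  [/\ is_clique Gam C, 0 < m & forall x, x \notin C -> #|Gam x :&: C| = m].

Definition regular_clique Gam C : Prop := exists m, m_regular_clique m Gam C.

Definition neumaier_graph v k lam m s Gam : Prop :=
  [/\ edge_regular v k lam Gam, ~ complete_graph Gam
    & exists2 C, m_regular_clique m Gam C & #|C| = s].

Definition is_spread Gam P : Prop :=
  partition P [set: V] /\ {in P, forall C, regular_clique Gam C}.

End Graphs.

Definition graph_isomorphic (V W : finType) (Gam : graph V) (Del : graph W) :
    Prop :=
  exists2 f : V -> W,
    bijective f & forall x y, (f y \in Del (f x)) = (y \in Gam x).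

Definition Cay (gT : finGroupType) (S : {set gT}) : graph gT :=
  [ffun g => S :* g].

(* Cay S is a Cayley graph only for such S. *)
Definition connection_set (gT : finGroupType) (S : {set gT}) : Prop :=
  1 \notin S /\ S^-1 = S.

(* The equation for k is in int, to avoid truncated subtraction. *)
Definition feasible (v k lam m s : nat) : Prop :=
  [/\ 0 < m, 0 < s, s %| v,
      (k%:Z = s%:Z - 1 + ((v %/ s)%N%:Z - 1) * m%:Z)%R & k < v.-1].

Definition subsets_of_card (T : finType) (m : nat) (A : {set T}) :
    {set {set T}} :=
  [set X : {set T} | X \subset A & #|X| == m].

(* The cosets are numbered from 1: Hg_1, ..., Hg_n is the list of right cosets
   of H, without repetition; g i is irrelevant for other i. *)
Definition coset_numbering (gT : finGroupType) (H : {set gT}) (n : nat)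
    (g : nat -> gT) : Prop :=
  perm_eq [seq H :* g i | i <- iota 1 n] (enum (rcosets H [set: gT])).

Definition orbit_representatives (gT : finGroupType) (A : {set gT}) (m : nat)
    (S2 : {set {set gT}}) : Prop :=
  is_transversal S2
    (orbit 'P^* 'N_(Aut [set: gT])(A | 'P) @: subsets_of_card m A)
    (subsets_of_card m A).

(* The algorithm is a nondeterministic program: the order in which each loop
   runs through its candidates is left open.
   - Next j : the loop over T_j is about to take its next candidate;
   - Enter j : T_2, ..., T_(j-1) are chosen, and the loop over T_j is about to
     be set up, or, if j = n + 1, T is about to be tested;
   - Stop : all loops have finished. *)
Inductive control := Next of nat | Enter of nat | Stop.

(* todo j holds the candidates that the loop over T_j has not yet tried (these
   are the sets \overline{T_j} if j > 2); out is the current value of N. *)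
Record state (gT : finGroupType) := State {
  pc : control;
  chosen : nat -> {set gT};
  todo : nat -> {set {set gT}};
  out : {set graph gT}
}.

Section Algorithm.

Variables (gT : finGroupType) (lam m s : nat).
Variables (H : {set gT}) (n : nat) (g : nat -> gT).

Implicit Types (T : nat -> {set gT}) (L : nat -> {set {set gT}}).
Implicit Types (N : {set graph gT}).

(* R_j; this is empty for j = 2. *)
Definition forced T j : {set gT} :=
  H :* g j :&: \bigcup_(2 <= i < j) (T i)^-1.

(* For j = 2 this is the test made on T_2. *)
Definition consistent T j : bool :=
  (T j)^-1 :&: ((\bigcup_(2 <= i < j.+1) H :* g i)
                  :\: \bigcup_(2 <= i < j.+1) T i) == set0.

Definition accepted (T : {set gT}) : bool :=
  [&& T == T^-1,
      [forall h in H^#, #|T :* h :&: T|%:Z == lam%:Z - s%:Z + 2]%R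
    & [forall x in T, #|T :* x :&: T|%:Z == lam%:Z - 2 * m%:Z + 2]%R].

Inductive step : state gT -> state gT -> Prop :=
| step_choose j X T L N :
    X \in L j ->
    let T' := [eta T with j |-> X :|: forced T j] in
    step (State (Next j) T L N)
         (State (if consistent T' j then Enter j.+1 else Next j)
                T' [eta L with j |-> L j :\ X] N)
| step_exhausted j T L N :
    L j = set0 ->
    step (State (Next j) T L N)
         (State (if j == 2 then Stop else Next j.-1) T L N)
| step_discard j T L N :
    j <= n -> m < #|forced T j| ->
    step (State (Enter j) T L N) (State (Next j.-1) T L N)
| step_enter j T L N :
    j <= n -> #|forced T j| <= m ->
    let candidates :=
      subsets_of_card (m - #|forced T j|) (H :* g j :\: forced T j) in
    step (State (Enter j) T L N)
         (State (Next j) T [eta L with j |-> candidates] N)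
| step_test T L N :
    let U := \bigcup_(2 <= i < n.+1) T i in
    step (State (Enter n.+1) T L N)
         (State (Next n) T L
                (if accepted U then Cay (H^# :|: U) |: N else N)).

Definition run : state gT -> state gT -> Prop := clos_refl_trans _ step.

Definition initial (S2 : {set {set gT}}) : state gT :=
  State (Next 2) (fun=> set0) [eta (fun=> set0) with 2 |-> S2] set0.

(* No execution is infinite, and none gets stuck before Stop. *)
Definition finishes (st : state gT) : Prop :=
  Acc (fun st2 st1 => step st1 st2) st /\
  forall st1, run st st1 -> pc st1 = Stop \/ exists st2, step st1 st2.

Definition outputs (st : state gT) (N : {set graph gT}) : Prop :=
  exists2 st1, run st st1 & pc st1 = Stop /\ out st1 = N.

End Algorithm.

(* Main.v *)
Require Import Defs.
From mathcomp Require Import all_boot all_order all_algebra all_fingroup.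
From mathcomp Require Import zify.

(** Write the connection set of a Cayley graph with a spread given by the
    H-cosets as H^# together with T, where T is disjoint from H. Counting common
    neighbours shows that such a graph has the required parameters iff T = T^-1,
    T meets every other coset in m elements, and T passes the final test of the
    algorithm. An automorphism of G stabilising H g_2 stabilises H, so up to
    isomorphism T may be assumed to meet H g_2 in one of the representatives.
    For such a T the algorithm can never discard a partial choice agreeing with
    T: until the graph has been found, some loop whose outer loops agree with T
    still has the right candidate to try. *)

Set Implicit Arguments.
Unset Strict Implicit.
Unset Printing Implicit Defensive.

Import GroupScope.

(** * Counting common neighbours in Cayley graphs *)

Section CayleyGraphs.

Variable gT : finGroupType.
Implicit Types (S T : {set gT}) (H : {group gT}) (x y : gT).

Lemma mem_Cay S x y : (y \in Cay S x) = (y * x^-1 \in S).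
Proof. by rewrite ffunE mem_rcoset. Qed.

Lemma card_Cay S x : #|Cay S x| = #|S|.
Proof. by rewrite ffunE card_rcoset. Qed.

(** Right translations are automorphisms of [Cay S], so only [y * x^-1] matters. *)
Lemma card_Cay_common S x y :
  #|Cay S x :&: Cay S y| = #|S :* (y * x^-1) :&: S|.
Proof.
rewrite -(card_rcoset (_ :&: S) x); apply: eq_card => z.
rewrite !inE !mem_Cay !mem_rcoset !inE !mem_rcoset invMg invgK -mulgA mulKg.
by rewrite andbC.
Qed.

Lemma card_Cay_rcoset S H x y :
  #|Cay S x :&: H :* y| = #|S :&: H :* (y * x^-1)|.
Proof.
rewrite -(card_rcoset (S :&: _) x); apply: eq_card => z.
by rewrite !inE mem_Cay !mem_rcoset !inE !mem_rcoset invMg invgK -mulgA mulKg.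
Qed.

Lemma simple_Cay S : connection_set S -> simple_graph (Cay S).
Proof.
case=> S1 SV; split=> x => [|y]; first by rewrite mem_Cay mulgV.
by rewrite !mem_Cay -{1}SV inE invMg invgK.
Qed.

Lemma rcosets_id H : (H : {set gT}) \in rcosets H [set: gT].
Proof. by rewrite -{1}(rcoset1 H) mem_rcosets mulSGid ?subsetT ?inE. Qed.

(** The conditions on the part [T] of a connection set outside [H]; for [0 < m] they make every
    right coset of [H] an [m]-regular clique of [Cay (H^# :|: T)]. *)
Definition coset_regular H (m : nat) T : Prop :=
  [/\ T^-1 = T, [disjoint T & H] & forall x, x \notin H -> #|T :&: H :* x| = m].

Lemma card_coset_regular H m T :
  coset_regular H m T -> #|T| = (#|[set: gT] : H|.-1 * m)%N.
Proof.
case=> _ dTH Tm.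
rewrite -sum1_card (partition_big (fun x => H :* x)
  [in rcosets H [set: gT] :\ (H : {set gT})]) /=; last first.
  move=> x Tx; rewrite !inE -rcosetE imset_f // rcosetE andbT.
  by apply/eqP => Hx; rewrite -Hx in dTH; move/pred0P/(_ x): dTH;
     rewrite /= Tx rcoset_refl.
rewrite (eq_bigr (fun=> m)) => [|C].
  rewrite sum_nat_const; congr (_ * _)%N.
  by rewrite /indexg (cardsD1 (H : {set gT}) (rcosets _ _)) rcosets_id.
case/setD1P=> CH /rcosetsP[x _ defC]; rewrite defC in CH *.
rewrite sum1dep_card -(Tm x); last by apply: contra CH => /rcoset_id ->.
by apply: eq_card => y; rewrite !inE; congr (_ && _); rewrite eq_sym;
   apply/eqP/idP => [->|/rcoset_eqP //]; rewrite rcoset_refl.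
Qed.

(** Inside [H], the common neighbours of [1] and [h] are all elements but [1] and [h]; outside [H]
    they form [T :* h :&: T]. *)
Lemma card_subgroup_common H T h :
    [disjoint T & H] -> h \in H^# ->
  (#|(H^# :|: T) :* h :&: (H^# :|: T)| + 2 = #|H| + #|T :* h :&: T|)%N.
Proof.
move=> dTH /setD1P[h1 Hh].
have HT x : x \in H -> x \in T = false by move=> Hx; apply: (disjointFl dTH).
rewrite -(cardsID H (_ :&: _)) addnAC; congr (_ + _)%N.
  rewrite (cardsD1 1 H) (cardsD1 h (H :\ 1)) group1 !inE h1 Hh.
  rewrite addnA addnC; congr (_ + _)%N; apply: eq_card => x.
  rewrite !inE mem_rcoset !inE groupMr ?groupV // -eq_mulgV1.
  case Hx: (x \in H); rewrite ?andbF //= !andbT.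
  by rewrite !HT ?groupM ?groupV // !orbF andbC.
apply: eq_card => x.
rewrite !inE !mem_rcoset !inE groupMr ?groupV //.
case Hx: (x \in H); rewrite ?andbF //=.
by rewrite (HT x) ?andbF.
Qed.

(** The common neighbours of [1] and [t] are split among [H], [H :* t] and the rest. The first two
    parts have [m - 1] elements each, since [1] and [t] respectively drop out; the rest is
    [T :* t :&: T]. *)
Lemma card_outer_common H m T t :
    coset_regular H m T -> t \in T ->
  (#|(H^# :|: T) :* t :&: (H^# :|: T)| + 2 = 2 * m + #|T :* t :&: T|)%N.
Proof.
case=> TV dTH Tm Tt.
have TH x : x \in T -> x \in H = false by move=> Tx; apply: (disjointFr dTH).
have HT x : x \in H -> x \in T = false by move=> Hx; apply: (disjointFl dTH).
have Ht := TH t Tt.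
have Tt' : t^-1 \in T by rewrite -TV inE invgK.
rewrite -(cardsID H (_ :&: _)) -(cardsID (H :* t) (_ :\: H)).
have -> : #|(((H^# :|: T) :* t :&: (H^# :|: T)) :\: H) :\: H :* t|
          = #|T :* t :&: T|.
  apply: eq_card => x; rewrite !inE !mem_rcoset !inE.
  case Tx: (x \in T); rewrite ?andbF //=.
    rewrite (TH x Tx) orbT !andbT /=.
    by case Hxt: (_ \in H); rewrite ?andbF ?(HT _ Hxt) ?orbF.
  by rewrite ?orbF; case: (x \in H); rewrite ?andbF.
have d : (#|((H^# :|: T) :* t :&: (H^# :|: T)) :&: H| + 1 = m)%N.
  rewrite -(Tm t^-1) ?groupV ?Ht // -(card_rcoset (T :&: _) t).
  rewrite (cardsD1 1 (_ :* t)) mem_rcoset mul1g inE Tt' rcoset_refl addnC.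
  congr (_ + _)%N; apply: eq_card => x.
  rewrite !inE !mem_rcoset !inE mem_rcoset invgK mulgKV.
  case Hx: (x \in H); rewrite ?andbF //= !andbT.
  by rewrite (HT x) // orbF groupMl // groupV Ht andbF andbC.
have e : (#|(((H^# :|: T) :* t :&: (H^# :|: T)) :\: H) :&: H :* t| + 1 = m)%N.
  rewrite -(Tm t) ?Ht // (cardsD1 t (T :&: _)) inE Tt rcoset_refl addnC.
  congr (_ + _)%N; apply: eq_card => x.
  rewrite !inE !mem_rcoset !inE -eq_mulgV1.
  case Tx: (x \in T); rewrite ?andbF ?orbF /=.
    rewrite (TH x Tx) orbT !andbT /=.
    by case Hxt: (_ \in H); rewrite ?andbF // (HT _ Hxt) orbF !andbT.
  by case: (x \in H); rewrite ?andbF.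
by lia.
Qed.

End CayleyGraphs.

Lemma acceptedP (gT : finGroupType) (lam m s : nat) (H T : {set gT}) :
  reflect [/\ T^-1 = T,
              forall h, h \in H^# -> (#|T :* h :&: T| + s = lam + 2)%N
            & forall x, x \in T -> (#|T :* x :&: T| + 2 * m = lam + 2)%N]
          (accepted lam m s H T).
Proof.
have natE (a b c : nat) : (a%:Z == b%:Z - c%:Z + 2)%R = (a + c == b + 2)%N.
  by apply/eqP/eqP; lia.
apply: (iffP and3P) => -[TV accH accT].
  split=> [|h /(forall_inP accH)|x /(forall_inP accT)]; first exact/esym/eqP.
    by rewrite natE => /eqP.
  by rewrite -PoszM natE => /eqP.
split; first by rewrite TV.
  by apply/forall_inP => h /accH; rewrite natE => ->.
by apply/forall_inP => x /accT; rewrite -PoszM natE => ->.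
Qed.

(** * Connection sets of Neumaier graphs with a coset spread *)

Section CosetSpread.

Variables (gT : finGroupType) (H : {group gT}) (v k lam m s : nat).
Hypothesis ltHG : H \proper [set: gT].
Hypothesis feas : feasible v k lam m s.
Hypothesis vE : v = #|[set: gT]|.
Hypothesis sE : s = #|H|.
Implicit Types S T : {set gT}.

Lemma index_gt1 : 1 < #|[set: gT] : H|.
Proof. by rewrite indexg_gt1; case/andP: ltHG. Qed.

Lemma feasible_index : k = (s.-1 + #|[set: gT] : H|.-1 * m)%N.
Proof.
case: feas => _ s0 _ + _.
have -> : (v %/ s)%N = #|[set: gT] : H| by rewrite vE sE divgS ?subsetT.
by move: index_gt1; set i := #|_ : _|; nia.
Qed.

Lemma coset_regular_connection T :
  coset_regular H m T -> connection_set (H^# :|: T).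
Proof.
case=> TV dTH _; split; first by rewrite !inE eqxx /= (disjointFl dTH) ?group1.
by apply/setP=> x; rewrite !inE -{2}TV inE groupV invg_eq1.
Qed.

Lemma coset_regular_neumaier T :
    coset_regular H m T -> accepted lam m s H T ->
  neumaier_graph v k lam m s (Cay (H^# :|: T)) /\
  is_spread (Cay (H^# :|: T)) (rcosets H [set: gT]).
Proof.
move=> Treg /acceptedP[_ accH accT].
have Sconn := coset_regular_connection Treg.
have [TV dTH Tm] := Treg.
have cliqueH C : C \in rcosets H [set: gT] ->
    m_regular_clique m (Cay (H^# :|: T)) C.
  case/rcosetsP=> y _ ->; split=> [x z xHy zHy xz||x xHy]; last 2 first.
  - by case: feas.
  - have xy : y * x^-1 \notin H.
      by apply: contra xHy; rewrite mem_rcoset -groupV invMg invgK.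
    rewrite card_Cay_rcoset -(Tm _ xy); apply: eq_card => z.
    rewrite !inE mem_rcoset.
    case: (boolP (z \in H)) => Hz; last by rewrite andbF.
    by rewrite groupMl // groupV (negPf xy) !andbF.
  rewrite mem_Cay 3!inE -eq_mulgV1 eq_sym xz /=.
  move: xHy zHy; rewrite !mem_rcoset => xHy zHy.
  by rewrite -(mulgKV y z) -mulgA groupM // -(invgK (y * _)) invMg invgK groupV.
have card_S : #|H^# :|: T| = k.
  rewrite cardsU (_ : _ :&: T = set0) ?cards0 ?subn0.
    by rewrite (card_coset_regular Treg) feasible_index sE (cardsD1 1 H) group1.
  apply/setP=> x; rewrite !inE; case Tx: (x \in T); rewrite ?andbF //.
  by rewrite (disjointFr dTH Tx) andbF.
split; last first.
  split=> [|C /cliqueH ?]; last by exists m.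
  exact: rcosets_partition (subsetT _).
split.
- split; [exact: simple_Cay | by rewrite vE cardsT
         | by move=> x; rewrite card_Cay |].
  move=> x y; rewrite mem_Cay card_Cay_common; set z := y * _.
  case/setUP=> Sz.
    move: (accH z Sz) (card_subgroup_common dTH Sz); rewrite -sE.
    by set a := #|(_ :|: _) :* _ :&: _|; set b := #|T :* _ :&: _|; lia.
  move: (accT z Sz) (card_outer_common Treg Sz).
  by set a := #|(_ :|: _) :* _ :&: _|; set b := #|T :* _ :&: _|; lia.
(* Completeness would force degree at least [v.-1]. *)
- move=> complS; case: feas => _ _ _ _.
  rewrite -card_S -(card_Cay _ 1) vE (cardsD1 1 [set: gT]) inE /= ltnNge.
  move/negP; apply; apply: subset_leq_card; apply/subsetP=> y /setD1P[y1 _].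
  by apply: complS; rewrite eq_sym.
exists (H : {set gT}); last by rewrite sE.
exact/cliqueH/rcosets_id.
Qed.

Lemma neumaier_coset_regular S :
    connection_set S -> neumaier_graph v k lam m s (Cay S) ->
    is_spread (Cay S) (rcosets H [set: gT]) ->
  [/\ coset_regular H m (S :\: H), accepted lam m s H (S :\: H)
    & S = H^# :|: S :\: H].
Proof.
move=> Sconn [[_ _ kreg edge] _ _] [_ cliques].
have [S1 SV] := Sconn.
have [m' [Hclique m'0 Hreg]] := cliques H (rcosets_id H).
have defS : S = H^# :|: S :\: H.
  apply/setP=> x; rewrite !inE.
  case Hx: (x \in H); rewrite ?andbF ?andbT //= orbF.
  have [-> | x1 /=] := eqVneq x 1; first exact: negPf.
  have := Hclique 1 x (group1 _) Hx.
  by rewrite eq_sym mem_Cay invg1 mulg1 => ->.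
have TV : (S :\: H)^-1 = S :\: H by rewrite invDg SV invGid.
have dTH : [disjoint S :\: H & H].
  by rewrite disjoint_subset; apply/subsetP => x; rewrite !inE => /andP[].
have Treg' : coset_regular H m' (S :\: H).
  (* Right translation by [x] turns the neighbours of [x^-1] in [H] into [S :&: H :* x]. *)
  split=> // x Hx; rewrite -(Hreg x^-1) ?groupV //.
  have := card_Cay_rcoset S H x^-1 1; rewrite rcoset1 mul1g invgK => ->.
  apply: eq_card => y; rewrite !inE mem_rcoset.
  case: (boolP (y \in H)) => //= Hy.
  by rewrite groupMl // groupV (negPf Hx) andbF.
have card_S : k = (s.-1 + #|S :\: H|)%N.
  rewrite -(kreg 1) card_Cay {1}defS cardsU (_ : _ :&: _ = set0) ?cards0 ?subn0.
    by rewrite sE (cardsD1 1 H) group1.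
  by apply/setP=> x; rewrite !inE; case: (x \in H); rewrite ?andbF.
(* The spread gives [H] some constant [m']; as the index exceeds 1, the degree determines it. *)
have mE : m' = m.
  move: card_S; rewrite (card_coset_regular Treg') feasible_index => /addnI/eqP.
  by rewrite eqn_pmul2l; [move/eqP | have := index_gt1; case: #|_ : _|].
rewrite {}mE in Treg'; split=> //; apply/acceptedP; split=> // [h Hh | t Tt].
  have := card_subgroup_common dTH Hh; rewrite -defS -sE.
  have := edge 1 h; rewrite mem_Cay card_Cay_common invg1 mulg1 {1}defS inE Hh.
  by move=> /(_ isT) ->; set a := #|_ :* _ :&: _|; lia.
have := card_outer_common Treg' Tt; rewrite -defS.
have := edge 1 t.
rewrite mem_Cay card_Cay_common invg1 mulg1 {1}defS inE Tt orbT.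
by move=> /(_ isT) ->; set a := #|_ :* _ :&: _|; lia.
Qed.

End CosetSpread.

(** * Automorphisms preserving [H] *)

Section Automorphisms.

Variables (gT : finGroupType) (H : {group gT}) (sigma : {perm gT}).
Hypothesis sigmaM : {morph sigma : x y / x * y}.
Hypothesis sigmaH : forall x, (sigma x \in H) = (x \in H).
Implicit Types S T : {set gT}.

Lemma aut1 : sigma 1 = 1.
Proof. by apply: (mulgI (sigma 1)); rewrite -sigmaM !mulg1. Qed.

Lemma autV x : sigma x^-1 = (sigma x)^-1.
Proof. by apply: (mulgI (sigma x)); rewrite -sigmaM !mulgV aut1. Qed.

Lemma mem_aut_imset S x : (sigma x \in sigma @: S) = (x \in S).
Proof. by rewrite mem_imset //; apply: perm_inj. Qed.

Lemma aut_imset_rcosetI S T x :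
  sigma @: T :&: (sigma @: S) :* sigma x = sigma @: (T :&: S :* x).
Proof.
(* Writing each [z] as [sigma y] reduces membership in images to membership of [y]. *)
apply/setP=> z; rewrite -(permKV sigma z); set y := _ z.
by rewrite mem_aut_imset !inE !mem_rcoset -autV -sigmaM !mem_aut_imset.
Qed.

Lemma aut_imset_id : sigma @: H = H.
Proof.
apply/setP=> z; rewrite -(permKV sigma z); set y := _ z.
by rewrite mem_aut_imset sigmaH.
Qed.

Lemma aut_coset_regular m T :
  coset_regular H m T -> coset_regular H m (sigma @: T).
Proof.
case=> TV dTH Tm; split.
- apply/setP=> z; rewrite -(permKV sigma z); set y := _ z.
  by rewrite inE -autV !mem_aut_imset -{2}TV inE.
- rewrite disjoint_subset; apply/subsetP=> _ /imsetP[x Tx ->].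
  by rewrite inE sigmaH (disjointFr dTH).
move=> z; rewrite -(permKV sigma z); set y := _ z => Hy.
rewrite -aut_imset_id aut_imset_rcosetI card_imset; last exact: perm_inj.
by apply: Tm; rewrite -sigmaH.
Qed.

Lemma aut_accepted lam m s T :
  accepted lam m s H T -> accepted lam m s H (sigma @: T).
Proof.
case/acceptedP=> TV accH accT; apply/acceptedP.
have cardE x : #|(sigma @: T) :* sigma x :&: sigma @: T| = #|T :* x :&: T|.
  rewrite setIC aut_imset_rcosetI card_imset; last exact: perm_inj.
  by rewrite setIC.
split=> [|z|z].
- apply/setP=> z; rewrite -(permKV sigma z); set y := _ z.
  by rewrite inE -autV !mem_aut_imset -{2}TV inE.
- rewrite -(permKV sigma z); set y := _ z => /setD1P[y1 Hy].
  rewrite cardE accH //; rewrite sigmaH in Hy; rewrite !inE Hy andbT.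
  by apply: contraNneq y1 => ->; rewrite aut1.
rewrite -(permKV sigma z); set y := _ z.
by rewrite mem_aut_imset cardE => /accT.
Qed.

Lemma aut_Cay S : graph_isomorphic (Cay S) (Cay (sigma @: S)).
Proof.
exists sigma; first exact: (Bijective (permK sigma) (permKV sigma)).
by move=> x y; rewrite !mem_Cay -autV -sigmaM mem_aut_imset.
Qed.

Lemma aut_imset_connection T :
  sigma @: (H^# :|: T) = H^# :|: sigma @: T.
Proof.
apply/setP=> z; rewrite -(permKV sigma z); set y := _ z.
rewrite mem_aut_imset !inE mem_aut_imset sigmaH.
by rewrite -{2}aut1 (inj_eq perm_inj).
Qed.

End Automorphisms.

(* An automorphism fixing one right coset of H fixes H, because
   H = (H x) y^-1 for every y in H x. *)
Lemma astabs_rcoset (gT : finGroupType) (H : {group gT}) (x : gT)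
    (sigma : {perm gT}) :
    sigma \in 'N_(Aut [set: gT])(H :* x | 'P) ->
  {morph sigma : y z / y * z} /\ forall y, (sigma y \in H) = (y \in H).
Proof.
case/setIP=> /Aut_morphic/morphicP sM /astabsP sHx.
have sigmaM y z : sigma (y * z) = sigma y * sigma z by apply: sM; rewrite inE.
have HxE y : (sigma y \in H :* x) = (y \in H :* x) by exact: sHx.
split=> // y; have /rcosetP[h Hh sx] : sigma x \in H :* x.
  by rewrite HxE rcoset_refl.
have := HxE (y * x); rewrite sigmaM sx !mem_rcoset -!mulgA mulgV !mulg1.
by rewrite groupMr.
Qed.

Lemma orbit_representatives_orbit (gT : finGroupType) (A : {set gT}) (m : nat)
    (S2 : {set {set gT}}) (X : {set gT}) :
    orbit_representatives A m S2 -> X \in subsets_of_card m A ->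
  exists2 sigma, sigma \in 'N_(Aut [set: gT])(A | 'P) & sigma @: X \in S2.
Proof.
case/and3P=> _ _ /forall_inP repr AX.
have := repr _ (imset_f _ AX).
(* The transversal meets the orbit of [X] in exactly one set, so the intersection is nonempty. *)
have [-> | [Y]] := set_0Vmem (S2 :&: orbit 'P^* 'N_(Aut [set: gT])(A | 'P) X).
  by rewrite cards0.
case/setIP=> S2Y /orbitP[sigma Nsigma defY] _; exists sigma => //.
by move: S2Y; rewrite -defY /= /setact.
Qed.

(** * Right cosets and their numbers *)

Section CosetNumbering.

Variables (gT : finGroupType) (H : {group gT}) (n : nat) (g : nat -> gT).
Hypothesis gnum : coset_numbering H n g.
Hypothesis g1 : g 1 = 1.

Lemma rcoset_numbering_inj i j :
    0 < i <= n -> 0 < j <= n -> H :* g i = H :* g j -> i = j.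
Proof.
move=> i_n j_n eHij; have: uniq [seq H :* g i | i <- iota 1 n].
  by rewrite (perm_uniq gnum) enum_uniq.
(* Shifting the numbering to start at 0 turns the list into an [mkseq]. *)
rewrite (iotaDl 1 0) -map_comp => /mkseq_uniqP inj.
have := inj i.-1 j.-1; rewrite !inE /= !add1n.
by case: i j i_n j_n eHij {inj} => [|i] [|j] //= i_n j_n -> /(_ i_n j_n erefl)->.
Qed.

Lemma mem_numbered_rcoset x :
  x \notin H -> exists2 i, 1 < i <= n & x \in H :* g i.
Proof.
move=> Hx; have: H :* x \in [seq H :* g i | i <- iota 1 n].
  by rewrite (perm_mem gnum) mem_enum mem_rcosets mulSGid ?subsetT ?inE.
case/mapP=> i; rewrite mem_iota => /andP[i0 i_n] eHx.
exists i; last by rewrite -eHx rcoset_refl.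
rewrite -[i <= n]ltnS i_n andbT ltn_neqAle i0 andbT.
by apply: contraNneq Hx => e1; rewrite -(rcoset1 H) -g1 e1 -eHx rcoset_refl.
Qed.

Lemma numbering_notin i : 1 < i <= n -> g i \notin H.
Proof.
case/andP=> i1 i_n; apply/negP => Hgi.
suff: i = 1%N by lia.
apply: rcoset_numbering_inj; first lia; first lia.
by rewrite g1 rcoset1 rcoset_id.
Qed.

End CosetNumbering.

Lemma bigcup_natP (T : finType) (a b : nat) (F : nat -> {set T}) (x : T) :
  reflect (exists2 i, a <= i < b & x \in F i) (x \in \bigcup_(a <= i < b) F i).
Proof.
have -> : (x \in \bigcup_(a <= i < b) F i)
          = has (fun i => x \in F i) (index_iota a b).
  by elim: index_iota => [|i r IHr]; rewrite ?big_nil ?big_cons !inE //= IHr.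
apply: (iffP hasP) => -[i ab Fi]; exists i => //.
  by rewrite -mem_index_iota.
by rewrite mem_index_iota.
Qed.

(** * Invariants of the states of the algorithm *)

Section Algorithm.

Variables (gT : finGroupType) (H : {group gT}) (n lam m s : nat).
Variable g : nat -> gT.
Hypothesis gnum : coset_numbering H n g.
Hypothesis g1 : g 1 = 1.
Hypothesis n_gt1 : 1 < n.

Implicit Types (T : nat -> {set gT}) (L : nat -> {set {set gT}}).
Implicit Types (st : state gT) (U : {set gT}).

Notation stp := (step lam m s H n g).
Notation candidates T j :=
  (subsets_of_card (m - #|forced H g T j|) (H :* g j :\: forced H g T j)).

Lemma run_invariant (P : state gT -> Prop) st st' :
    (forall st1 st2, stp st1 st2 -> P st1 -> P st2) ->
  run lam m s H n g st st' -> P st -> P st'.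
Proof. by move=> stepP; elim=> [? ? /stepP | | ]; auto. Qed.

Lemma eq_forced T T' j :
    (forall i, 1 < i < j -> T i = T' i) -> forced H g T j = forced H g T' j.
Proof.
by move=> eqT; congr (_ :&: _); apply: eq_big_nat => i /eqT->.
Qed.

(** The bound [b] leaves out stale values that earlier iterations left at higher indices. *)
Definition partial_transversal (b : nat) T : Prop :=
  forall i, 1 < i < b -> T i \subset H :* g i /\ #|T i| = m.

Definition open_loops (b : nat) T L : Prop :=
  forall i, 1 < i < b -> #|forced H g T i| <= m /\ L i \subset candidates T i.

(** The choice of the innermost open loop [b.-1] may change, because [forced] at [i] reads only
    choices below [i]. *)
Lemma open_loops_eq b T T' L L' :
    (forall i, i.+1 < b -> T i = T' i) ->
    (forall i, i < b -> L' i \subset L i) ->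
  open_loops b T L -> open_loops b T' L'.
Proof.
move=> eqT subL openL i i_b.
have e : forced H g T i = forced H g T' i.
  by apply: eq_forced => l /andP[_ li]; apply: eqT; lia.
have [] := openL i i_b; rewrite e; split=> //.
by apply: subset_trans (subL i _) _; first by case/andP: i_b.
Qed.

(** In [Next j] loop [j] is open but its own choice may be stale. [Enter j] needs [2 < j], as the
    loop over [T_2] is set up in the initial state. *)
Definition well_formed st : Prop :=
  match pc st with
  | Next j => [/\ 1 < j <= n, partial_transversal j (chosen st)
                & open_loops j.+1 (chosen st) (todo st)]
  | Enter j => [/\ 2 < j <= n.+1, partial_transversal j (chosen st)
                 & open_loops j (chosen st) (todo st)]
  | Stop => True
  end.

Lemma well_formed_step st st' : stp st st' -> well_formed st -> well_formed st'.
Proof.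
case=> [j X T L N LX T' | j T L N Lj0 | j T L N j_n big | j T L N j_n small cand
       | T L N U]; rewrite /well_formed /=.
- move=> [j_n partT openL].
  have openL' : open_loops j.+1 T' [eta L with j |-> L j :\ X].
    apply: open_loops_eq openL => i i_j; rewrite /T' /=; case: eqP => //.
      by lia.
    by move=> ->; apply: subD1set.
  have partT' : partial_transversal j.+1 T'.
    move=> i i_j; rewrite /T' /=; case: eqP => [{i i_j}-> | ne_ij]; last first.
      by apply: partT; lia.
    have [|sm /subsetP/(_ X LX)] := openL j; first lia.
    rewrite inE subsetD => /andP[/andP[XH dX] /eqP cX].
    split; first by rewrite subUset XH subsetIl.
    (* Equality holds for disjoint sets, so the new choice has [(m - #|R_j|) + #|R_j| = m]
       elements. *)
    have [_] := leq_card_setU X (forced H g T j); rewrite dX => /eqP->.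
    by rewrite cX subnK.
  by case: ifP => _; split=> // i i_j; apply: partT'; lia.
- case=> j_n partT openL; case: eqP => // j2; split; first lia.
    by move=> i i_j; apply: partT; lia.
  by move=> i i_j; apply: openL; lia.
- case=> j_n' partT openL; split; first lia.
    by move=> i i_j; apply: partT; lia.
  by move=> i i_j; apply: openL; lia.
- case=> j_n' partT openL; split=> //; first lia.
  move=> i i_j /=; case: eqP => [-> //|ne_ij].
  by apply: openL; lia.
case=> j_n partT openL; split; [by rewrite n_gt1 /= | | by []].
by move=> i i_j; apply: partT; lia.
Qed.

(** * Termination *)

(* The weight of loop j exceeds what setting up and completing all the loops
   inside it can cost; the summand j makes backtracking decrease the measure. *)
Definition weight j := ((#|{: {set gT}}| + n + 3) ^ (n + 2 - j))%N.

(** In [Enter j] the candidate just removed from loop [j.-1] still counts with its weight, to pay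
    for the work inside that loop. *)
Definition measure st : nat :=
  match pc st with
  | Next j => (\sum_(2 <= i < j.+1) #|todo st i| * weight i + j)%N
  | Enter j => (\sum_(2 <= i < j) #|todo st i| * weight i + weight j.-1)%N
  | Stop => 0
  end.

Lemma weight_gt0 j : 0 < weight j.
Proof. by rewrite expn_gt0; apply/orP; left; lia. Qed.

(** One candidate of loop [j] outweighs any set of candidates for loop [j.+1], with enough left to
    cover the summand [j] of [measure]. *)
Lemma weightS j : j <= n ->
  (#|{: {set gT}}| * weight j.+1 + n + 3 <= weight j)%N.
Proof.
move=> j_n; rewrite {2}/weight (_ : n + 2 - j = (n + 2 - j.+1).+1)%N; last lia.
rewrite expnS -/(weight j.+1) -!addnA mulnDl leq_add2l.
by rewrite leq_pmulr ?weight_gt0.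
Qed.

Lemma measure_step st st' :
  stp st st' -> well_formed st -> measure st' < measure st.
Proof.
have other L L' j : (forall i, i < j -> L' i = L i) ->
    (\sum_(2 <= i < j) #|L' i| * weight i
     = \sum_(2 <= i < j) #|L i| * weight i)%N.
  by move=> eqL; apply: eq_big_nat => i /andP[_ /eqL->].
case=> [j X T L N LX T' | j T L N Lj0 | j T L N j_n big | j T L N j_n small cand
       | T L N U]; rewrite /well_formed /measure /=.
- case=> j_n _ _; case: ifP => _ /=.
    rewrite !big_nat_recr; try lia.
    rewrite /= eqxx (cardsD1 X (L j)) LX (other L); last first.
      by move=> i i_j /=; case: eqP => //; lia.
    by rewrite mulnDl mul1n; set a := bigop _ _ _; set b := muln #|_| _; lia.
  rewrite !big_nat_recr; try lia.
  rewrite /= eqxx (cardsD1 X (L j)) LX (other L); last first.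
    by move=> i i_j /=; case: eqP => //; lia.
  have := weight_gt0 j; rewrite mulnDl mul1n.
  by set a := bigop _ _ _; set b := muln #|_| _; lia.
- case=> j_n _ _; case: eqP => [|j2] /=; first lia.
  rewrite prednK; last lia.
  by rewrite big_nat_recr ?Lj0 ?cards0 /=; [set a := bigop _ _ _; lia | lia].
(* Here and in the two cases below, the reserved weight of the enclosing loop pays for the step. *)
- case=> j_n' _ _; have := @weightS j.-1; rewrite prednK; last lia.
  by set a := bigop _ _ _; set b := muln _ (weight j); lia.
- case=> j_n' _ _; rewrite big_nat_recr /=; last lia.
  rewrite eqxx (other L); last by move=> i i_j /=; case: eqP => //; lia.
  have := @weightS j.-1; rewrite prednK; last lia.
  have : (#|cand| * weight j <= #|{: {set gT}}| * weight j)%N.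
    by rewrite leq_mul2r max_card orbT.
  set a := bigop _ _ _; set b := muln #|cand| _; set c := muln #|_| _; lia.
case=> j_n _ _ /=; have := @weightS n (leqnn _).
by set a := bigop _ _ _; set b := muln _ (weight _); lia.
Qed.

Lemma step_progress st :
  well_formed st -> pc st = Stop \/ exists st', stp st st'.
Proof.
case: st => [[j|j|] T L N]; rewrite /well_formed /=; last by left.
  case=> j_n _ _; right; have [Lj0 | [X LX]] := set_0Vmem (L j).
    by eexists; apply: step_exhausted.
  by eexists; apply: step_choose LX.
case=> j_n _ _; right; have [j_le_n | n_lt_j] := leqP j n.
  have [small | big] := leqP #|forced H g T j| m.
    by eexists; apply: step_enter.
  by eexists; apply: step_discard.
have -> : j = n.+1 by lia.
by eexists; apply: step_test.
Qed.

Lemma well_formed_finishes st : well_formed st -> finishes lam m s H n g st.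
Proof.
move=> wf; split; last first.
  move=> st' runst; apply: step_progress.
  exact: (run_invariant well_formed_step runst wf).
have [k] := ubnP (measure st); elim: k st wf => [|k IHk] st wf lek.
  by rewrite ltn0 in lek.
constructor=> st' step_st; apply: IHk; first exact: well_formed_step step_st wf.
by apply: leq_trans (measure_step step_st wf) _; rewrite -ltnS.
Qed.

(** * Soundness of the output *)

Definition sound st : Prop :=
  forall Gam, Gam \in out st ->
  exists U, [/\ coset_regular H m U, accepted lam m s H U
              & Gam = Cay (H^# :|: U)].

(** The cosets numbered from 2 to [n] are disjoint and cover the complement of [H], so [U] meets
    [H :* g i] exactly in [T i]. *)
Lemma partial_transversal_coset_regular T :
    let U := \bigcup_(2 <= i < n.+1) T i in
  partial_transversal n.+1 T -> U^-1 = U -> coset_regular H m U.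
Proof.
move=> U partT UV.
have UP x : reflect (exists2 i, 1 < i <= n & x \in T i) (x \in U).
  by apply: (iffP (bigcup_natP 2 n.+1 T x)) => -[i]; exists i.
split=> //.
  rewrite disjoint_subset; apply/subsetP=> x /UP[i i_n Tx].
  rewrite !inE; have [/subsetP/(_ x Tx) Hgx _] := partT i i_n.
  apply: contra (numbering_notin gnum g1 i_n) => Hx.
  by move: Hgx; rewrite mem_rcoset groupMl ?groupV.
move=> x /(mem_numbered_rcoset gnum g1)[i i_n Hgx].
have [sTi <-] := partT i i_n; apply: eq_card => y; rewrite inE.
apply/andP/idP => [[/UP[j j_n Ty] Hxy] | Ty]; last first.
  split; first by apply/UP; exists i.
  by rewrite (rcoset_eqP Hgx) (subsetP sTi).
have [/subsetP/(_ y Ty)/rcoset_eqP eHy _] := partT j j_n.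
have -> // : i = j.
apply: (rcoset_numbering_inj gnum); [lia | lia | rewrite -eHy].
by rewrite -(rcoset_eqP Hgx) (rcoset_eqP Hxy).
Qed.

Lemma sound_step st st' : stp st st' -> well_formed st -> sound st -> sound st'.
Proof.
case=> // T L N U; rewrite /well_formed /sound /= => -[_ partT _] soundN Gam.
case: ifP => [accU | _]; last exact: soundN.
case/setU1P=> [-> | /soundN //]; exists U; split=> //.
by apply: partial_transversal_coset_regular => //; case/acceptedP: accU.
Qed.

(** * Completeness: a fixed set [U] cannot be missed *)

Section Completeness.

Variable U : {set gT}.
Hypothesis Ureg : coset_regular H m U.
Hypothesis accU : accepted lam m s H U.

Let target i := U :&: H :* g i.

(* Some open loop has yet to try the candidate leading to U, and the loops
   around it currently agree with U. *)
Definition pending (b : nat) T L : Prop :=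
  exists i, [/\ 1 < i < b, forall l, 1 < l < i -> T l = target l
              & target i :\: forced H g T i \in L i].

(** With [False] at [Stop], an execution satisfying this can end only with the graph in the
    output. *)
Definition complete st : Prop :=
  Cay (H^# :|: U) \in out st \/
  match pc st with
  | Next j => pending j.+1 (chosen st) (todo st)
  | Enter j => (forall l, 1 < l < j -> chosen st l = target l) \/
               pending j (chosen st) (todo st)
  | Stop => False
  end.

(** Since [U] is closed under inversion, inverses of earlier parts of [U] lie in [U]. *)
Lemma forced_target_sub T j :
  (forall l, 1 < l < j -> T l = target l) -> forced H g T j \subset target j.
Proof.
move=> eqT; apply/subsetP=> x /setIP[Hx]; case/bigcup_natP=> i /eqT ->.
rewrite !inE => /andP[Ux _].
by case: Ureg => UV _ _; rewrite -UV inE Ux.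
Qed.

Lemma card_target j : 1 < j <= n -> #|target j| = m.
Proof.
move=> j_n; case: Ureg => _ _; apply.
exact: (numbering_notin gnum g1 j_n).
Qed.

(** Inverses of elements of [T j] lie in [U]; one falling into an already treated coset is therefore
    in the part chosen there. *)
Lemma consistent_target T j :
  (forall l, 1 < l < j.+1 -> T l = target l) -> 1 < j -> consistent H g T j.
Proof.
move=> eqT j1; rewrite /consistent -subset0; apply/subsetP=> x.
rewrite eqT ?j1 /= // => /setIP[]; rewrite !inE => /andP[Ux _] /andP[].
case: Ureg => UV _ _; have {}Ux: x \in U by rewrite -UV inE.
move=> xT /bigcup_natP[i i_j Hx]; case/bigcup_natP: xT.
by exists i; rewrite // eqT // inE Ux.
Qed.

Lemma bigcup_target : \bigcup_(2 <= i < n.+1) target i = U.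
Proof.
apply/setP=> x; apply/bigcup_natP/idP => [[i _ /setIP[]] //|Ux].
case: Ureg => _ dUH _; have /(mem_numbered_rcoset gnum g1) : x \notin H.
  by rewrite (disjointFr dUH).
by case=> i i_n Hx; exists i; rewrite // inE Ux.
Qed.

Lemma complete_step st st' :
  stp st st' -> well_formed st -> complete st -> complete st'.
Proof.
have pendingE b T T' L i :
    1 < i < b -> (forall l, 1 < l < i -> T l = target l) ->
    (forall l, l < i -> T' l = T l) -> target i :\: forced H g T i \in L i ->
    pending b T' L.
  move=> i_b eqT eqT' Li; exists i; split=> //.
    by move=> l l_i; rewrite eqT' ?eqT //; case/andP: l_i.
  rewrite (@eq_forced T' T) // => l l_i; apply: eqT'; by case/andP: l_i.
case=> [j X T L N LX T' | j T L N Lj0 | j T L N j_n big | j T L N j_n small cand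
       | T L N V]; rewrite /well_formed /complete /=.
- case=> j_n partT openL [|[i [i_j eqT Li]]]; first by left.
  right; have eqT' l : l < j -> T' l = T l.
    by rewrite /T' /= => lj; case: eqP => //; lia.
  (* A pending loop outside loop [j] is unaffected by this choice. *)
  have [lt_ij | le_ji] := ltnP i j.
    have pend b : j <= b -> pending b T' [eta L with j |-> L j :\ X].
      move=> le_jb; apply: (@pendingE b T T' _ i) => //; try lia.
        by move=> l l_i; apply: eqT'; lia.
      by rewrite /=; case: eqP => //; lia.
    by case: ifP => _ /=; [right|]; apply: pend; lia.
  have e_ij : i = j by lia.
  rewrite {i i_j le_ji}e_ij in eqT Li.
  (* If loop [j] itself is pending, either [X] completes to the part of [U] in this coset and passes
     the test, or the right candidate remains untried. *)
  have [eX | neX] := eqVneq X (target j :\: forced H g T j).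
    have T'j : T' j = target j.
      rewrite /T' /= eqxx eX setUC.
      rewrite -[X in X :|: _](setIidPr (forced_target_sub eqT)).
      exact: setID.
    have eqT'' l : 1 < l < j.+1 -> T' l = target l.
      move=> l_j; have [-> // | ne] := eqVneq l j.
      by rewrite eqT'; [apply: eqT; lia | lia].
    rewrite consistent_target //=; [by left | by lia].
  have pend : pending j.+1 T' [eta L with j |-> L j :\ X].
    apply: (@pendingE _ T T' _ j) => //; first lia.
    by rewrite /= eqxx !inE eq_sym neX.
  by case: ifP => _ /=; [right|].
- case=> j_n partT openL [|[i [i_j eqT Li]]]; first by left.
  (* An exhausted loop is not pending, so an outer one is; this excludes [j = 2], hence stopping. *)
  right; have ne_ij : i != j by apply: contraTneq Li => ->; rewrite Lj0 inE.
  case: eqP => [|j2]; first lia.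
  by exists i; split=> //; lia.
- case=> j_n' partT openL [|[eqT | [i [i_j eqT Li]]]]; first by left.
    (* A discard is impossible here: the forced set lies in a set of size [m]. *)
    have := subset_leq_card (forced_target_sub eqT).
    by rewrite card_target; lia.
  by right; exists i; split=> //; lia.
- case=> j_n' partT openL [|[eqT | [i [i_j eqT Li]]]]; first by left.
    (* The newly opened loop contains the right candidate, which makes it pending. *)
    right; exists j; split=> //; first lia.
    rewrite /= eqxx inE setSD ?subsetIr //= cardsD.
    rewrite (setIidPr (forced_target_sub eqT)) card_target //; lia.
  right; exists i; split=> //; first lia.
  by rewrite /=; case: eqP => //; lia.
case=> n_n partT openL [CayU | [eqT | pend]]; first 1 last.
- have -> : V = U.
    by rewrite -bigcup_target; apply: eq_big_nat => i; apply: eqT.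
  by left; rewrite accU setU11.
- by right.
by left; case: ifP => // _; rewrite inE CayU orbT.
Qed.

End Completeness.

End Algorithm.

(** * From the initial state to the final output *)

Theorem proposition5p2 (gT : finGroupType) (H : {group gT}) (n : nat)
    (g : nat -> gT) (v k lam m s : nat) (S2 : {set {set gT}}) :
  H \proper [set: gT] ->
  n = #|[set: gT] : H| ->
  coset_numbering H n g ->
  g 1%N = 1 ->
  feasible v k lam m s ->
  v = #|[set: gT]| ->
  s = #|H| ->
  orbit_representatives (H :* g 2) m S2 ->
  finishes lam m s H n g (initial S2) /\
  forall N : {set graph gT}, outputs lam m s H n g (initial S2) N ->
    (forall Gam : graph gT, Gam \in N ->
       (exists2 S : {set gT}, connection_set S & Gam = Cay S) /\
       neumaier_graph v k lam m s Gam /\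
       is_spread Gam (rcosets H [set: gT])) /\
    (forall S : {set gT}, connection_set S ->
       neumaier_graph v k lam m s (Cay S) ->
       is_spread (Cay S) (rcosets H [set: gT]) ->
       exists2 Gam : graph gT, Gam \in N & graph_isomorphic (Cay S) Gam).
Proof.
move=> ltHG nE gnum g1 feas vE sE repr.
have n_gt1 : 1 < n by rewrite nE; exact: index_gt1 ltHG.
have wf0 : well_formed H n m g (initial S2).
  split=> [|i i2|i i2]; first by rewrite n_gt1.
    by move: i2; lia.
  have -> : i = 2 by move: i2; lia.
  (* [R_2] is empty, so the candidates for [T_2] are [m]-subsets of [H :* g 2], as the members of
     [S2] are. *)
  have -> : forced H g (chosen (initial S2)) 2 = set0.
    by rewrite /forced big_geq // setI0.
  rewrite cards0 subn0 setD0 /=; split=> //.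
  by case/and3P: repr.
split=> [|N [st runst [stopst outst]]].
  exact: (well_formed_finishes lam s n_gt1 wf0).
rewrite -{}outst; split=> [Gam NGam | S Sconn Sneu Sspread].
  have [_ snd] : well_formed H n m g st /\ sound H lam m s st.
    apply: (run_invariant (P := fun st => _ /\ sound H lam m s st)) runst _.
      move=> st1 st2 step12 [wf1 sound1].
      split; first exact: (well_formed_step n_gt1 step12 wf1).
      exact: (sound_step gnum g1 n_gt1 step12 wf1 sound1).
    by split=> // Gam'; rewrite inE.
  have [U [Ureg accU ->]] := snd _ NGam.
  split; last exact: (coset_regular_neumaier ltHG feas vE sE Ureg accU).
  by exists (H^# :|: U) => //; exact: coset_regular_connection Ureg.
have [Treg accT defS] :=
  neumaier_coset_regular ltHG feas vE sE Sconn Sneu Sspread.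
set T := S :\: H in Treg accT defS.
have Hg2 : g 2 \notin H by exact: (numbering_notin gnum g1).
(* [sigma] moves the part of [T] in [H :* g 2] to a representative; the run is then followed with
   [sigma @: T] as target. *)
have [|sigma Nsigma S2T] :=
  orbit_representatives_orbit (X := T :&: H :* g 2) repr.
  by rewrite inE subsetIr /=; case: Treg => _ _ ->.
have [sigmaM sigmaH] := astabs_rcoset Nsigma.
have Ureg := aut_coset_regular sigmaM sigmaH Treg.
have accU := aut_accepted sigmaM sigmaH accT.
exists (Cay (H^# :|: sigma @: T)); last first.
  by rewrite -(aut_imset_connection sigmaM sigmaH) -defS; exact: aut_Cay.
have [_] : well_formed H n m g st /\ complete H g (sigma @: T) st.
  apply: (run_invariant (P := fun st => _ /\ complete H g _ st)) runst _.
    move=> st1 st2 step12 [wf1 compl1].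
    split; first exact: (well_formed_step n_gt1 step12 wf1).
    exact: (complete_step gnum g1 n_gt1 Ureg accU step12 wf1 compl1).
  split=> //; right; exists 2; split=> // [l|]; first by lia.
  rewrite /forced big_geq // setI0 setD0 /=.
  (* As [sigma] stabilises this coset, the image of [T] meets it in the chosen representative, so
     loop 2 is pending at the start. *)
  have g2E : H :* g 2 = sigma @: (H :* g 2).
    have [_ /astabsP sHg2] := setIP Nsigma.
    apply/setP=> z; rewrite -(permKV sigma z); set y := _ z.
    by rewrite mem_aut_imset -(sHg2 y).
  rewrite g2E; suff <- : sigma @: (T :&: H :* g 2)
                         = sigma @: T :&: sigma @: (H :* g 2) by [].
  by apply: imsetI => ? ? _ _; apply: perm_inj.
by case=> //; rewrite stopst.
Qed.
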